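(* For any type $\sigma$ and any sequence of blocks $\delta=(d_1^{m_1},\ldots,d_s^{m_s})$, \[ p_{\sigma}^{\otimes}P_{\delta}=\sum_{\tau} \left[\sum_{T\in\mathrm{ICRPT}(\tau,(\sigma;\delta))} \operatorname{wt}(T)\right] p_{\tau}^{\otimes}, \] where the outer sum is over types $\tau$ and $\mathrm{ICRPT}(\tau,(\sigma;\delta))$ is the set of increasing constant-row $P$-tableaux of shape $\tau$ and extended content $(\sigma;\delta)$.
   Context: An integer partition is a finite (possibly empty) weakly decreasing sequence of positive integers. A block is an ordered pair of positive integers written $d^m$ (degree $d$, multiplicity $m$). Blocks are ordered by $a^b\ge d^e$ iff $a>d$, or $a=d$ and $b\ge e$. A type is a finite (possibly empty) weakly decreasing sequence of blocks. For $k\ge1$, $\tau|_k$ denotes the integer partition formed by the multiplicities of the blocks of $\tau$ of degree $k$; the type $\tau$ is determined by $(\tau|_k)_{k\ge1}$. The tensor diagram of $\tau$ is the sequence of partition diagrams $\mathrm{dg}(\tau|_1)\otimes\mathrm{dg}(\tau|_2)\otimes\cdots$; the $k$th component has rows (left-justified, longest at top) of lengths the parts of $\tau|_k$. Variables: $x_{k,j}$ for $k,j\ge 1$, with $\deg x_{k,j}=k$; $\mathbf{x}_{k*}=(x_{k,1},x_{k,2},\dots)$. The algebra $\mathsf{P\Lambda}$ of polysymmetric functions consists of the formal series over $\mathbb{Q}$ of bounded degree in all the $x_{k,j}$ that, for each fixed $k$, are unchanged by any permutation of the variables $\mathbf{x}_{k*}$. Define $p^{\otimes}_\tau=\prod_{k\ge1}p_{\tau|_k}(\mathbf{x}_{k*})$,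 where $p_\lambda$ is the power-sum symmetric function. Define $P_d=\sum_{k\mid d}k\sum_{j\ge1}x_{k,j}^{d/k}$, let $P_{d^m}$ be obtained from $P_d$ by replacing every variable $x_{k,j}$ by $x_{k,j}^m$, and set $P_\delta=\prod_{i=1}^sP_{d_i^{m_i}}$. An increasing constant-row $P$-tableau (ICRPT) of shape $\tau$ and extended content $(\sigma;\delta)$, where $\delta=(d_1^{m_1},\dots,d_s^{m_s})$, is a filling $T$ of the cells of the tensor diagram of $\tau$ with integers $0,1,\dots,s$ such that: (i) each row of each component is constant; (ii) for $1\le i\le s$, exactly one row in the tensor diagram of $\tau$ contains the value $i$, and if that row lies in component $k$ and has length $r$, then $k$ divides $d_i$ and $rk=d_im_i$; (iii) the cells containing $0$ form a sub-tensor diagram equal to that of $\sigma$, i.e., for each $k$ the multiset of lengths of the rows of component $k$ filled with $0$ is the multiset of parts of $\sigma|_k$; (iv) for each $r,k$, the values in the rows of length $r$ in component $k$ weakly increase reading down the first column. (There are no such fillings unless every $\tau|_k$ contains each part of $\sigma|_k$ with at least the same multiplicity.) The weight is $\operatorname{wt}(T)=\prod_{k\ge1}k^{n_k(T)}$, where $n_k(T)$ is the number of rows of component $k$ containing a nonzero value. *)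

(* Defs.v *)
From HB Require Import structures.
From mathcomp Require Import all_boot all_order all_algebra.
From mathcomp Require Import finmap multiset.
From mathcomp Require Import boolp classical_sets functions cardinality fsbigop.

Set Implicit Arguments.
Unset Strict Implicit.
Unset Printing Implicit Defensive.

Import Order.TTheory GRing.Theory Num.Theory.

Local Open Scope fset_scope.
Local Open Scope mset_scope.
Local Open Scope ring_scope.

Record posnat := PosNat { pn :> nat; _ : (0 < pn)%N }.
HB.instance Definition _ := [isSub for pn].
HB.instance Definition _ := [Countable of posnat by <:].

Lemma posnat_gt0 (k : posnat) : (0 < k)%N. Proof. exact: valP. Qed.

Record intpart := IntPart {
  parts :> seq posnat;
  _ : sorted (fun r s : posnat => s <= r)%N parts }.
HB.instance Definition _ := [isSub for parts].
HB.instance Definition _ := [Countable of intpart by <:].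

(* The block $d^m$ is the pair (d, m). *)
Definition block := (posnat * posnat)%type.

Definition block_ge (b c : block) : bool :=
  (c.1 < b.1)%N || (b.1 == c.1) && (c.2 <= b.2)%N.

Record btype := BType {
  blocks :> seq block;
  _ : sorted block_ge blocks }.
HB.instance Definition _ := [isSub for blocks].
HB.instance Definition _ := [Countable of btype by <:].

Lemma block_ge_trans : transitive block_ge.
Proof.
move=> [b1 b2] [a1 a2] [c1 c2]; rewrite /block_ge /=.
case/orP=> [ba|/andP[/eqP-> ab2]] /orP[cb|/andP[/eqP<- cb2]].
- by rewrite (ltn_trans cb ba).
- by rewrite ba.
- by rewrite cb.
- by rewrite eqxx (leq_trans cb2 ab2) orbT.
Qed.

Lemma restr_subproof (tau : btype) (k : posnat) :
  sorted (fun r s : posnat => s <= r)%N [seq b.2 | b <- tau & b.1 == k].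
Proof.
have: sorted block_ge [seq b <- tau | b.1 == k].
  by apply: sorted_filter; [exact: block_ge_trans | case: tau].
have: all [pred b : block | b.1 == k] [seq b <- tau | b.1 == k].
  exact: filter_all.
elim: [seq _ <- _ | _] => // b [|c s] IH // /= /and3P[/eqP bk /eqP ck sk].
case/andP=> bc cs; apply/andP; split; last by apply: IH; rewrite //= ck eqxx.
by move: bc; rewrite /block_ge bk ck eqxx ltnn.
Qed.

(* The partition $\tau|_k$. *)
Definition restr (tau : btype) (k : posnat) : intpart :=
  IntPart (restr_subproof tau k).

(* The pair (k, j) stands for $x_{k,j}$. *)
Definition pvar := (posnat * posnat)%type.

(* A monomial is the multiset of its variables, so that [m v] is the exponent
   of [v] in [m] and the sum of multisets is the product of monomials. *)
Definition monom := {mset pvar}.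
HB.instance Definition _ := Choice.on monom.

Definition mdeg (m : monom) : nat := (\sum_(v <- finsupp m) m v * v.1)%N.

Record series := Series { coef : monom -> rat }.
HB.instance Definition _ := gen_eqMixin series.
HB.instance Definition _ := gen_choiceMixin series.

Lemma seriesP (f g : series) : coef f =1 coef g <-> f = g.
Proof.
by split=> [|-> //]; case: f g => [f] [g] /= fg; congr Series; apply: funext.
Qed.

Definition sadd (f g : series) := Series (fun m => coef f m + coef g m).
Definition sopp (f : series) := Series (fun m => - coef f m).
Definition sscale (a : rat) (f : series) := Series (fun m => a * coef f m).
Definition smon (n : monom) := Series (fun m => (m == n)%:R).
(* The finitely many factorizations of m as a product of two monomials *)
Definition mfact (m : monom) : set (monom * monom) :=
  [set ab : monom * monom | (ab.1 `+` ab.2)%mset = m]%classic.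
Definition smul (f g : series) := Series (fun m =>
  \sum_(ab \in mfact m)
    coef f ab.1 * coef g ab.2).

Fact saddA : associative sadd.
Proof. by move=> f g h; apply/seriesP => m /=; rewrite addrA. Qed.
Fact saddC : commutative sadd.
Proof. by move=> f g; apply/seriesP => m /=; rewrite addrC. Qed.
Fact sadd0 : left_id (Series (fun=> 0)) sadd.
Proof. by move=> f; apply/seriesP => m /=; rewrite add0r. Qed.
Fact saddN : left_inverse (Series (fun=> 0)) sopp sadd.
Proof. by move=> f; apply/seriesP => m /=; rewrite addNr. Qed.

HB.instance Definition _ := GRing.isZmodule.Build series saddA saddC sadd0 saddN.

Lemma coef0 m : coef 0 m = 0. Proof. by []. Qed.
Lemma coefD f g m : coef (f + g) m = coef f m + coef g m. Proof. by []. Qed.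
Lemma coefN f m : coef (- f) m = - coef f m. Proof. by []. Qed.

Fixpoint msubs (s : seq pvar) : seq monom :=
  if s is v :: s' then msubs s' ++ [seq v +` a | a <- msubs s']
  else [:: mset0].

Lemma mem_msubs (s : seq pvar) (a : monom) :
  (forall v, a v <= count_mem v s)%N -> a \in msubs s.
Proof.
elim: s a => [|v s IH] a /= le_as.
  by rewrite inE; apply/eqP/msetP => v; have := le_as v; rewrite mset0E leqn0 => /eqP.
rewrite mem_cat; have [av|av] := boolP (v \in a); last first.
  rewrite IH // => w; have := le_as w; case: eqVneq => [<-|//].
  by move/mset_eq0P: av => ->.
apply/orP; right; apply/mapP; exists (a `\ v); last by rewrite msetB1K.
apply: IH => w; rewrite msetB1E leq_subLR eq_sym; exact: le_as.
Qed.

Definition mdivs (m : monom) : seq monom := undup (msubs (enum_mset m)).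

Lemma mem_mdivs (m a : monom) : (forall v, a v <= m v)%N -> a \in mdivs m.
Proof.
by move=> am; rewrite mem_undup; apply: mem_msubs => v; rewrite count_mem_mset.
Qed.

Lemma mdivsl (m a b : monom) : a `+` b = m -> a \in mdivs m.
Proof. by move=> <-; apply: mem_mdivs => v; rewrite msetE2 leq_addr. Qed.
Lemma mdivsr (m a b : monom) : a `+` b = m -> b \in mdivs m.
Proof. by rewrite msetDC; exact: mdivsl. Qed.


Lemma mdivs_finite (m : monom) :
  finite_set (mfact m).
Proof.
apply: (@sub_finite_set _ _
  [set` [fset ab in [seq (a, b) | a <- mdivs m, b <- mdivs m]]%fset]%classic);
  last exact: finite_fset.
move=> [a b] /= abm; rewrite inE /=; apply/allpairsP; exists (a, b) => /=.
by rewrite (mdivsl abm) (mdivsr abm).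
Qed.

Lemma mdivs_uniq m : uniq (mdivs m). Proof. exact: undup_uniq. Qed.

Lemma coefM_seq (D : seq monom) (m : monom) f g : uniq D ->
    (forall a b : monom, a `+` b = m -> (a \in D) && (b \in D)) ->
  coef (smul f g) m =
  \sum_(a <- D) \sum_(b <- D) (a `+` b == m)%:R * (coef f a * coef g b).
Proof.
move=> uD Dm.
transitivity (\sum_(ab \in mfact m)
    (ab.1 `+` ab.2 == m)%:R * (coef f ab.1 * coef g ab.2)).
  by apply: eq_fsbigr => -[a b] /[!inE] /= abm; rewrite abm eqxx mul1r.
rewrite -(@big_allpairs_dep _ _ _ _ (fun=> _) _ (fun a b => (a, b)) D (fun=> D)
  (fun ab => (ab.1 `+` ab.2 == m)%:R * (coef f ab.1 * coef g ab.2))).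
rewrite [RHS]fsbig_seq ?allpairs_uniq //; last by case=> [? ?] [? ?] _ _ [-> ->].
apply: fsbig_widen => [[a b] abm|[a b] [_ /= /eqP/negbTE->]]; last first.
  by rewrite mul0r.
by apply/allpairsP; exists (a, b); have /andP[] := Dm _ _ abm.
Qed.


Lemma mdivs_closed m a b : a `+` b = m -> (a \in mdivs m) && (b \in mdivs m).
Proof. by move=> abm; rewrite (mdivsl abm) (mdivsr abm). Qed.

Definition coefM_divs m f g :=
  coefM_seq f g (mdivs_uniq m) (@mdivs_closed m).

Fact smulC : commutative smul.
Proof.
move=> f g; apply/seriesP => m; rewrite !coefM_divs exchange_big /=.
by do 2![apply: eq_bigr => ? _]; rewrite msetDC [coef f _ * _]mulrC.
Qed.

Fact smul1 : left_id (smon mset0) smul.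
Proof.
move=> f; apply/seriesP => m; rewrite coefM_divs.
have D0 : mset0 \in mdivs m by apply: (@mdivsl _ _ m); rewrite mset0D.
have Dm : m \in mdivs m by apply: (@mdivsr _ mset0); rewrite mset0D.
rewrite (bigD1_seq mset0) ?mdivs_uniq //= (bigD1_seq m) ?mdivs_uniq //=.
rewrite mset0D !eqxx !mul1r !big1 ?addr0 // => [a a0|b bm].
  by rewrite big1 // => b _; rewrite (negbTE a0) mul0r mulr0.
by rewrite mset0D (negbTE bm) mul0r.
Qed.

Fact smulDl : left_distributive smul +%R.
Proof.
move=> f g h; apply/seriesP => m; rewrite coefD !coefM_divs -big_split.
apply: eq_bigr => a _; rewrite -big_split; apply: eq_bigr => b _.
by rewrite coefD mulrDl mulrDr.
Qed.

Lemma coefM3 m f g h : coef (smul (smul f g) h) m =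
  \sum_(a <- mdivs m) \sum_(b <- mdivs m) \sum_(c <- mdivs m)
    (a `+` b `+` c == m)%:R * (coef f a * coef g b * coef h c).
Proof.
set D := mdivs m; rewrite coefM_divs -/D.
transitivity (\sum_(u <- D) \sum_(c <- D) \sum_(a <- D) \sum_(b <- D)
    (u `+` c == m)%:R * ((a `+` b == u)%:R * (coef f a * coef g b * coef h c))).
  apply: eq_bigr => u _; apply: eq_bigr => c _.
  case: eqP => [ucm|_]; last first.
    by rewrite mul0r big1 // => a _; rewrite big1 // => b _; rewrite mul0r.
  rewrite mul1r (@coefM_seq D u) ?mdivs_uniq // => [|a b abu]; last first.
    apply/andP; split; first by apply: (@mdivsl _ _ (b `+` c)); rewrite msetDA abu.
    by apply: (@mdivsr _ (a `+` c)); rewrite msetDAC abu.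
  rewrite mulr_suml; apply: eq_bigr => a _; rewrite mulr_suml.
  by apply: eq_bigr => b _; rewrite mul1r !mulrA.
under eq_bigr do rewrite exchange_big /=.
rewrite exchange_big /=; apply: eq_bigr => a _.
under eq_bigr do rewrite exchange_big /=.
rewrite exchange_big /=; apply: eq_bigr => b _.
rewrite exchange_big /=; apply: eq_bigr => c _.
have [abcm|abcm] := eqVneq (a `+` b `+` c) m; last first.
  rewrite mul0r big1 // => u _; case: (eqVneq (a `+` b) u) => [<-|_].
    by rewrite (negbTE abcm) mul0r.
  by rewrite mul0r mulr0.
rewrite (bigD1_seq (a `+` b)) ?mdivs_uniq //=; last exact: mdivsl abcm.
rewrite abcm !eqxx !mul1r big1 ?addr0 // => u; rewrite eq_sym => /negbTE->.
by rewrite mul0r mulr0.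
Qed.

Fact smulA : associative smul.
Proof.
move=> f g h; rewrite smulC; apply/seriesP => m; rewrite !coefM3.
under eq_bigr do rewrite exchange_big /=.
rewrite exchange_big /=; do 3![apply: eq_bigr => ? _].
by rewrite [_ `+` _]msetDC msetDA [_ * coef f _]mulrC -(mulrA (coef f _)).
Qed.

Fact smul1_neq0 : smon mset0 != 0.
Proof.
by apply/eqP => /seriesP/(_ mset0)/eqP; rewrite /= eqxx oner_eq0.
Qed.

HB.instance Definition _ := GRing.Zmodule_isComNzRing.Build series
  smulA smulC smul1 smulDl smul1_neq0.

Lemma coefM f g m :
  coef (f * g) m = \sum_(ab \in mfact m) coef f ab.1 * coef g ab.2.
Proof. by []. Qed.
Lemma coef1 m : coef 1 m = (m == mset0)%:R. Proof. by []. Qed.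

Fact sscaleA a b f : sscale a (sscale b f) = sscale (a * b) f.
Proof. by apply/seriesP => m /=; rewrite mulrA. Qed.
Fact sscale1 : left_id 1 sscale.
Proof. by move=> f; apply/seriesP => m /=; rewrite mul1r. Qed.
Fact sscaleDr : right_distributive sscale +%R.
Proof. by move=> a f g; apply/seriesP => m /=; rewrite mulrDr. Qed.
Fact sscaleDl f : {morph sscale^~ f : a b / a + b}.
Proof. by move=> a b; apply/seriesP => m /=; rewrite mulrDl. Qed.

HB.instance Definition _ := GRing.Zmodule_isLmodule.Build rat series
  sscaleA sscale1 sscaleDr sscaleDl.

Lemma coefZ a f m : coef (a *: f) m = a * coef f m. Proof. by []. Qed.

Fact sscaleAl (a : rat) (f g : series) : a *: (f * g) = (a *: f) * g.
Proof.
apply/seriesP => m; rewrite coefZ !coefM mulr_fsumr.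
by apply: eq_fsbigr => ab _; rewrite coefZ mulrA.
Qed.

HB.instance Definition _ := GRing.Lmodule_isLalgebra.Build rat series sscaleAl.
HB.instance Definition _ := GRing.Lalgebra_isComAlgebra.Build rat series.

(* The sum of a family such that every monomial has a nonzero coefficient in
   only finitely many members. A coefficient where this fails is set to 0. *)
Definition ssum (I : choiceType) (F : I -> series) : series :=
  Series (fun m => \sum_(i \in [set: I]%classic) coef (F i) m).

Lemma smonM a b : smon a * smon b = smon (a `+` b).
Proof.
apply/seriesP => m; rewrite coefM /=.
have [mab|mab] := eqVneq m (a `+` b); last first.
  rewrite fsbig1 // => -[a' b'] /= abm; case: eqP => [aa|]; rewrite ?mul0r //.
  case: eqP => [bb|]; rewrite ?mulr0 //.
  by move: mab; rewrite -abm /= aa bb eqxx.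
rewrite (fsbigD1 (a, b)) /=; last by rewrite mab.
  rewrite !eqxx mulr1 fsbig1 ?addr0 // => -[a' b'] /= [_ /eqP].
  by rewrite xpair_eqE; case: eqP; case: eqP; rewrite ?mul0r ?mulr0.
exact: mdivs_finite.
Qed.

(* The variable $x_{k,j}$, for v = (k, j). *)
Definition xvar (v : pvar) : series := smon [mset v].

Lemma xvarX v r : xvar v ^+ r = smon (msetn r v).
Proof.
elim: r => [|r IH]; first by rewrite msetn0.
rewrite exprS IH smonM; congr smon; apply/msetP => w.
by rewrite msetE2 !msetnE; case: eqP.
Qed.

Definition bounded_degree (f : series) : Prop :=
  exists n, forall m, coef f m != 0 -> (mdeg m <= n)%N.

(* Renaming of the variables $x_{k,j}$, $j \ge 1$, for one fixed k. *)
Definition rename (k : posnat) (g : posnat -> posnat) (v : pvar) : pvar :=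
  if v.1 == k then (v.1, g v.2) else v.

(* Whenever g is bijective, every monomial m is carried by the renaming to
   exactly one monomial m'. *)
Definition symmetric_in (k : posnat) (f : series) : Prop :=
  forall g, bijective g -> forall m m' : monom,
  (forall v, m' (rename k g v) = m v) -> coef f m' = coef f m.

Definition polysymmetric : {pred series} :=
  fun f => `[< bounded_degree f /\ forall k, symmetric_in k f >].

Lemma polysymmetricP f :
  reflect (bounded_degree f /\ forall k, symmetric_in k f) (f \in polysymmetric).
Proof. exact: asboolP. Qed.

Lemma mdegD a b : mdeg (a `+` b) = (mdeg a + mdeg b)%N.
Proof.
have E (m : monom) (S : {fset pvar}) : (finsupp m `<=` S)%fset ->
    mdeg m = (\sum_(v <- S) m v * v.1)%N.
  move=> mS; rewrite /mdeg (big_fset_incl _ mS) // => v _.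
  by rewrite memNfinsupp => /eqP->.
pose S := (finsupp a `|` finsupp b `|` finsupp (a `+` b))%fset.
rewrite !(E _ S) -?big_split /=; first last.
- exact: fsubsetUr.
- by rewrite /S -fsetUA fsubsetUl.
- by rewrite /S fsetUAC fsubsetUr.
by apply: eq_bigr => v _; rewrite msetE2 mulnDl.
Qed.

Lemma mdegn r v : mdeg (msetn r v) = (r * v.1)%N.
Proof.
rewrite /mdeg finsupp_msetn; case: posnP => [->|r0]; first by rewrite big_seq_fset0.
by rewrite big_seq_fset1 msetnxx.
Qed.

Section Rename.
Variables h h' : pvar -> pvar.
Hypotheses (hK : cancel h h') (h'K : cancel h' h).

Definition mrename (m : monom) : monom :=
  [fsfun v in [fset h u | u in finsupp m] => m (h' v)].

Lemma mrenameE m v : mrename m v = m (h' v).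
Proof.
rewrite fsfunE; case: ifPn => // /negP vm; apply/esym/eqP.
rewrite -memNfinsupp; apply/negP => hm; apply: vm.
by apply/imfsetP; exists (h' v); rewrite ?h'K.
Qed.

Lemma mrename_uniq (m m' : monom) : (forall v, m' (h v) = m v) -> m' = mrename m.
Proof. by move=> mm'; apply/msetP => v; rewrite mrenameE -mm' h'K. Qed.

Lemma mrenameD a b : mrename (a `+` b) = mrename a `+` mrename b.
Proof. by apply/msetP => v; rewrite !(mrenameE, msetE2). Qed.

Lemma mrename_mfact m : set_bij (mfact m) (mfact (mrename m))
  (fun ab => (mrename ab.1, mrename ab.2)).
Proof.
split=> [[a b] <- /=|[a b] [c d] _ _ [/msetP ac /msetP bd]|[a b] /= abm].
- by rewrite /mfact /= mrenameD.
- by congr pair; apply/msetP => v; rewrite -[v]hK -!mrenameE ?ac ?bd.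
pose i (n : monom) : monom := [fsfun v in [fset h' u | u in finsupp n] => n (h v)].
have iE n v : i n v = n (h v).
  rewrite fsfunE; case: ifPn => // /negP vn; apply/esym/eqP.
  rewrite -memNfinsupp; apply/negP => hn; apply: vn.
  by apply/imfsetP; exists (h v); rewrite ?hK.
exists (i a, i b) => /=; last first.
  by congr pair; apply/msetP => v; rewrite mrenameE iE h'K.
apply/msetP => v; rewrite /= msetE2 !iE -msetE2.
by have /msetP/(_ (h v)) := abm; rewrite mrenameE hK.
Qed.

End Rename.

Lemma renameK k g g' : cancel g g' -> cancel (rename k g) (rename k g').
Proof.
move=> gK [l j]; rewrite /rename /=.
by case: (eqVneq l k) => [->|lk] /=; rewrite ?eqxx ?gK // (negbTE lk).
Qed.
Arguments renameK k {g g'}.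

Fact polysymmetric_subalg : GRing.subalg_closed polysymmetric.
Proof.
split=> [|a f g /polysymmetricP[[n fn] fS] /polysymmetricP[[p gp] gS]|
          f g /polysymmetricP[[n fn] fS] /polysymmetricP[[p gp] gS]];
  apply/polysymmetricP.
- split=> [|k g [g' gK g'K] m m' mm'].
    exists 0 => m; rewrite coef1; case: (eqVneq m mset0) => [-> _|]; last first.
      by rewrite eqxx.
    by rewrite /mdeg big1_seq // => v _; rewrite mset0E.
  rewrite !coef1; congr (nat_of_bool _)%:R; apply/eqP/eqP => /msetP E.
    by apply/msetP => v; rewrite -mm' E !mset0E.
  apply/msetP => v; rewrite -[v](renameK k g'K) mm' E !mset0E //.
- split=> [|k h hB m m' mm']; last by rewrite !coefD !coefZ (fS k h hB m m') ?(gS k h hB m m').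
  exists (maxn n p) => m; rewrite coefD coefZ => fg.
  rewrite leq_max; apply/orP.
  have [f0|/fn] := eqVneq (coef f m) 0; [right|by left].
  by apply: gp; move: fg; rewrite f0 mulr0 add0r.
- split=> [|k h [h' hK h'K] m m' mm'].
    exists (n + p)%N => m; apply: contraNT; rewrite -ltnNge => npm.
    rewrite coefM fsbig1 // => -[a b] /= abm; apply/eqP; rewrite mulf_eq0.
    apply: contraLR npm; rewrite negb_or => /andP[/fn an /gp bp].
    by rewrite -leqNgt -abm mdegD leq_add.
  rewrite (mrename_uniq (renameK k h'K) mm') !coefM.
  rewrite (reindex_fsbig _ _ _ _ (mrename_mfact (renameK k hK) (renameK k h'K) m)) /=.
  apply: eq_fsbigr => -[a b] _ /=.
  have hB : bijective h by exists h'.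
  have E (n' : monom) v : mrename (rename k h) (rename k h') n' (rename k h v) = n' v.
    by rewrite (mrenameE (renameK k h'K)) (renameK k hK).
  by rewrite (fS k h hB a _ (E a)) (gS k h hB b _ (E b)).
Qed.

HB.instance Definition _ :=
  GRing.isSubalgClosed.Build rat series polysymmetric polysymmetric_subalg.

Record PLambda := PLam { psval :> series; _ : psval \in polysymmetric }.
HB.instance Definition _ := [isSub for psval].
HB.instance Definition _ := [Choice of PLambda by <:].
HB.instance Definition _ := [SubChoice_isSubComNzRing of PLambda by <:].
HB.instance Definition _ := [SubZmodule_isSubLmodule of PLambda by <:].
HB.instance Definition _ := [SubNzRing_SubLmodule_isSubLalgebra of PLambda by <:].
HB.instance Definition _ := [SubLalgebra_isSubAlgebra of PLambda by <:].


(* The power sum $p_r(x_{k*})$. For r = 0 the family is not summable, and the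
   junk value is 0. *)
Definition psum_series (k : posnat) (r : nat) : series :=
  ssum (fun j : posnat => xvar (k, j) ^+ r).

Fact psum_subproof k r : psum_series k r \in polysymmetric.
Proof.
apply/polysymmetricP; split=> [|l g gB m m' mm'].
  exists (r * k)%N => m; apply: contraNT; rewrite -ltnNge => rkm.
  rewrite /= fsbig1 // => j _; rewrite xvarX /=; case: eqP => // mE.
  by move: rkm; rewrite mE mdegn ltnn.
have [g' gK g'K] := gB.
have E j : (m' == msetn r (rename l g (k, j))) = (m == msetn r (k, j)).
  have gI := can_inj (renameK l gK).
  apply/eqP/eqP => /msetP E; apply/msetP => v.
    by rewrite -mm' E !msetnE (inj_eq gI).
  by rewrite -[v](renameK l g'K) mm' E !msetnE (inj_eq gI).
have F (n : monom) : coef (psum_series k r) n =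
    \sum_(j \in [set: posnat]%classic) coef (smon (msetn r (k, j))) n.
  by apply: eq_fsbigr => j _; rewrite xvarX.
have {}E j : coef (smon (msetn r (k, j))) m =
    coef (smon (msetn r (rename l g (k, j)))) m' by rewrite /= E.
rewrite !F; under [RHS]eq_fsbigr do rewrite E /rename /=.
by case: eqP => [_|//]; rewrite [LHS](reindex_fsbigT g _ gB).
Qed.

Definition psum (k : posnat) (r : nat) : PLambda := PLam (psum_subproof k r).

Definition mpow (e : nat) (m : monom) : monom :=
  [fsfun v in finsupp m => (e * m v)%N].

Lemma mpowE e m v : mpow e m v = (e * m v)%N.
Proof.
by rewrite fsfunE; case: ifPn => //; rewrite memNfinsupp => /eqP->; rewrite muln0.
Qed.

Lemma mpow_inj (e : posnat) : injective (mpow e).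
Proof.
move=> a b /msetP ab; apply/msetP => v; have := ab v.
by rewrite !mpowE => /eqP; rewrite eqn_pmul2l ?posnat_gt0 // => /eqP.
Qed.

(* The substitution of $x_{k,j}^e$ for every variable $x_{k,j}$ *)
Definition spow (e : posnat) (f : series) : series :=
  ssum (fun m : monom => coef f m *: smon (mpow e m)).

Lemma coef_spow (e : posnat) f m : coef (spow e f) (mpow e m) = coef f m.
Proof.
rewrite /= -(fsbig_widen [set m]%classic) //=; last first.
  move=> n [_ /= nm]; rewrite (inj_eq (@mpow_inj e)) eq_sym.
  by case: eqP => //; rewrite mulr0.
by rewrite fsbig_set1 eqxx mulr1.
Qed.

Lemma coef_spow0 (e : posnat) f n : (forall m, n != mpow e m) -> coef (spow e f) n = 0.
Proof. by move=> nE; rewrite /= fsbig1 // => m _; rewrite (negbTE (nE m)) mulr0. Qed.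

Lemma mdeg_pow (e : posnat) m : mdeg (mpow e m) = (e * mdeg m)%N.
Proof.
rewrite /mdeg big_distrr; have -> : finsupp (mpow e m) = finsupp m.
  apply/fsetP => v; rewrite !mem_finsupp mpowE muln_eq0.
  by have := posnat_gt0 e; rewrite lt0n => /negbTE->.
by apply: eq_bigr => v _; rewrite mpowE /= mulnA.
Qed.

Fact spow_subproof (e : posnat) (f : PLambda) : spow e f \in polysymmetric.
Proof.
have /polysymmetricP[[n fn] fS] := valP f; apply/polysymmetricP.
have P m : {a | m = mpow e a} + {forall a, m != mpow e a}.
  have [/cid[a ->]|H] := pselect (exists a, m = mpow e a); first by left; exists a.
  by right=> a; apply/eqP => E; apply: H; exists a.
split=> [|k g gB m m' mm'].
  exists (e * n)%N => m; have [[a ->]|m0] := P m; last by rewrite coef_spow0 ?eqxx.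
  by rewrite coef_spow mdeg_pow leq_pmul2l ?posnat_gt0 //; apply: fn.
have [g' gK g'K] := gB.
have [[a am]|m0] := P m; have [[a' am']|m0'] := P m'.
- rewrite am am' !coef_spow; apply: (fS k g) => // v.
  have := mm' v; rewrite am am' !mpowE => /eqP.
  by rewrite eqn_pmul2l ?posnat_gt0 // => /eqP.
- case/eqP: (m0' (mrename (rename k g) (rename k g') a)).
  apply/msetP => v; rewrite mpowE (mrenameE (renameK k g'K)).
  by rewrite -[v in LHS](renameK k g'K) mm' am mpowE.
- case/eqP: (m0 (mrename (rename k g') (rename k g) a')).
  by apply/msetP => v; rewrite mpowE (mrenameE (renameK k gK)) -mm' am' mpowE.
- by rewrite !coef_spow0.
Qed.

Definition pow_subst (e : posnat) (f : PLambda) : PLambda :=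
  PLam (spow_subproof e f).

Definition p_part (k : posnat) (la : intpart) : PLambda :=
  \prod_(r <- la) psum k r.

(* Only finitely many factors differ from 1. *)
Definition p_tensor (tau : btype) : PLambda :=
  \big[*%R/1]_(k \in [set: posnat]%classic) p_part k (restr tau k).

Definition P_deg (d : posnat) : PLambda :=
  \sum_(k \in [set k : posnat | (k %| d)%N]%classic) k%:R * psum k (d %/ k).

Definition P_block (b : block) : PLambda := pow_subst b.2 (P_deg b.1).

Definition P_seq (delta : seq block) : PLambda := \prod_(b <- delta) P_block b.

(* The length of row i, counted from 0, of the diagram of la *)
Definition row_len (la : intpart) (i : nat) : nat := nth 0%N [seq pn r | r <- la] i.

(* The cell in row i and column c, both counted from 0, is the pair (i, c). *)
Definition dg (la : intpart) : {fset nat * nat} :=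
  [fset (i, c) | i : nat in iota 0 (size la), c : nat in iota 0 (row_len la i)].

(* The cell (k, (i, c)) is the cell (i, c) of component k. *)
Definition tensor_dg (tau : btype) : {fset posnat * (nat * nat)} :=
  [fset (k, x) | k : posnat in [seq b.1 | b <- tau],
                 x : nat * nat in dg (restr tau k)].

Lemma mem_dg la i c : ((i, c) \in dg la) = (c < row_len la i)%N.
Proof.
apply/imfset2P/idP => [[i' _ [c' + [-> ->]]]|ci].
  by rewrite ?inE mem_iota.
have si : (i < size la)%N.
  by rewrite ltnNge; apply: contraL ci => si; rewrite /row_len nth_default ?size_map.
by exists i; rewrite ?inE ?mem_iota //; exists c; rewrite ?inE ?mem_iota.
Qed.

Lemma mem_tensor_dg tau k x :
  ((k, x) \in tensor_dg tau) = (x \in dg (restr tau k)).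
Proof.
apply/imfset2P/idP => [[k' _ [x' + [-> ->]]]|xk]; first by rewrite ?inE.
exists k; last by exists x.
apply: contraLR xk => kt.
case: x => i c; rewrite mem_dg /row_len /= (_ : [seq b <- tau | b.1 == k] = [::]).
  by rewrite nth_nil.
apply/eqP; rewrite -size_eq0 size_filter eqn0Ngt -has_count.
by apply: contra kt => /hasP[b bt /eqP <-]; apply: map_f.
Qed.

Section Tableaux.
Variables (tau sigma : btype) (delta : seq block).

Definition filling := {ffun tensor_dg tau -> 'I_(size delta).+1}.

Definition comp_of (u : tensor_dg tau) : posnat := (val u).1.
Definition row_of (u : tensor_dg tau) : nat := (val u).2.1.
Definition col_of (u : tensor_dg tau) : nat := (val u).2.2.

Definition in_row (k : posnat) (i : nat) (u : tensor_dg tau) : bool :=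
  (comp_of u == k) && (row_of u == i).

Definition zero_row (T : filling) (k : posnat) (i : nat) : bool :=
  [forall u, in_row k i u ==> (T u == ord0)].

Definition nonzero_row (T : filling) (k : posnat) (i : nat) : bool :=
  [exists u, in_row k i u && (T u != ord0)].

(* The block $d_t^{m_t}$, with t counted from 0, corresponds to the value t + 1. *)
Record is_ICRPT (T : filling) : Prop := {
  icrpt_row_constant : forall k i u v,
    in_row k i u -> in_row k i v -> T u = T v;
  icrpt_unique_row : forall t : 'I_(size delta),
    exists! ki : posnat * nat,
      exists2 u, in_row ki.1 ki.2 u & T u = t.+1 :> nat;
  icrpt_row_block : forall (t : 'I_(size delta)) k i u,
    in_row k i u -> T u = t.+1 :> nat ->
    let b := tnth (in_tuple delta) t in
    (k %| b.1)%N /\ (row_len (restr tau k) i * k = b.1 * b.2)%N;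
  icrpt_zero_rows : forall k,
    perm_eq [seq row_len (restr tau k) i |
               i <- iota 0 (size (restr tau k)) & zero_row T k i]
            [seq pn r | r <- restr sigma k];
  icrpt_increasing : forall k i j u v,
    row_len (restr tau k) i = row_len (restr tau k) j -> (i <= j)%N ->
    in_row k i u -> in_row k j v -> col_of u = 0%N -> col_of v = 0%N ->
    (T u <= T v)%N }.

Definition ICRPT : {set filling} := finset (fun T => `[< is_ICRPT T >]).

Definition n_nonzero (T : filling) (k : posnat) : nat :=
  count (nonzero_row T k) (iota 0 (size (restr tau k))).

(* Only finitely many factors differ from 1. *)
Definition wt (T : filling) : nat :=
  \big[muln/1%N]_(k \in [set: posnat]%classic) (k ^ n_nonzero T k)%N.

End Tableaux.

(* Main.v *)
Require Import Defs.
From HB Require Import structures.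
From mathcomp Require Import all_boot all_order all_algebra.
From mathcomp Require Import finmap multiset.
From mathcomp Require Import boolp classical_sets functions cardinality fsbigop.

Set Implicit Arguments.
Unset Strict Implicit.
Unset Printing Implicit Defensive.

Import GRing.Theory.

Local Open Scope ring_scope.

(** Because m (d / k) = (d m) / k, substituting powers in P_d turns P_(d^m) into
    the sum over the divisors k of d of k p_r(x_k), with r = d m / k
    ([P_blockE]). So P_delta is a sum over the ways of replacing each block
    d_t^m_t of delta by a block k_t^r_t with k_t | d_t and r_t k_t = d_t m_t;
    such a list bs of replacement blocks is a splitting of delta. Its
    coefficient is the product of the k_t, and its product with p_sigma is
    p_tau, where tau is sigma with the blocks of bs adjoined
    ([p_tensor_adjoin]). It remains to match, for each tau, the tableaux of
    shape tau with the splittings bs for which tau is sigma with bs adjoined.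

    The rows of the diagram of tau are the blocks of tau: a row of length r in
    component k is the block k^r. A tableau is constant on rows, so it amounts
    to a labelling of these blocks. Consider the rows that are equal to one
    block b; they are consecutive, and their labels increase weakly. The label 0
    occurs as often as b occurs in sigma, and t + 1 occurs once if the row
    holding t + 1 is a copy of b, and not at all otherwise. Let bs be the
    splitting whose entry t is the block of the row holding t + 1. Then the
    labels on the copies of b are forced by sigma and bs ([standard_labels]),
    so the tableau is determined by bs ([ICRPT_labels], [labels_inj]).
    Comparing the number of labels with the number of rows for every b gives
    that tau is sigma with bs adjoined. Conversely, if tau has that form then
    filling the copies of each b with the standard labels yields a tableau
    ([labels_fill], [ICRPT_of_labels]). This is the bijection [perm_ICRPT].

    The weight of the tableau is the product of the k_t, since component k has
    as many nonzero rows as there are blocks of degree k in tau but not in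
    sigma, i.e. in bs ([wt_ICRPT]). *)

(** * Adjoining blocks to a type *)

Lemma block_ge_total : total block_ge.
Proof.
move=> [a b] [c d]; rewrite /block_ge /=; case: ltngtP => //= [_|ac].
  by rewrite orbT.
by rewrite (val_inj ac : c = a) eqxx leq_total.
Qed.

Lemma block_ge_anti : antisymmetric block_ge.
Proof.
move=> [a b] [c d]; rewrite /block_ge /=.
case: ltngtP => [ca|ac|ac]; last first.
- rewrite (val_inj ac : c = a) eqxx /= -eqn_leq => /eqP db.
  by rewrite (val_inj db : d = b).
- by case: (a =P c) ac => [->|_ _ /=]; rewrite ?ltnn.
- by case: (c =P a) ca => [->|_ _ /=]; rewrite ?ltnn ?andbF.
Qed.

Definition adjoin (sigma : btype) (bs : seq block) : btype :=
  BType (sort_sorted block_ge_total (sigma ++ bs)).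

Lemma adjoin_eq sigma bs (tau : btype) :
  (adjoin sigma bs == tau) = perm_eq tau (sigma ++ bs).
Proof.
rewrite -val_eqE /=; apply/eqP/idP => [<-|ts].
  by rewrite perm_sort.
apply: (sorted_eq block_ge_trans block_ge_anti); rewrite ?sort_sorted //.
- exact: block_ge_total.
- by case: tau {ts}.
- by rewrite perm_sort perm_sym.
Qed.

(** Used for the products over all degrees and for the sum over all types. The
    sum over j has finite support, because only finitely many fibers of [key]
    meet s. *)
Lemma fsbig_fiber (R : Type) (idx : R) (op : Monoid.com_law idx)
    (I : eqType) (J : choiceType) (key : I -> J) (s : seq I) (F : I -> R) :
  \big[op/idx]_(j \in [set: J]%classic) \big[op/idx]_(i <- s | key i == j) F i =
  \big[op/idx]_(i <- s) F i.
Proof.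
rewrite (fsbigE (undup [seq key i | i <- s])) ?undup_uniq //=; last first.
  move=> j _; rewrite mem_undup => js; rewrite big_mkcond big1_seq //= => i si.
  by case: eqP => // ij; rewrite -ij map_f in js.
rewrite (exchange_big_dep xpredT) //=; rewrite !big_seq.
apply: eq_bigr => i si.
rewrite (eq_bigl (pred1 (key i))) => [|j]; last by rewrite inE eq_sym in_setT.
rewrite -big_filter filter_pred1_uniq ?undup_uniq ?mem_undup ?map_f //.
by rewrite big_seq1.
Qed.

(** The product over the degrees k of the products over the blocks of degree k
    is a product over all blocks, so the order of the blocks does not matter. *)
Lemma p_tensorE (tau : btype) : p_tensor tau = \prod_(b <- tau) psum b.1 b.2.
Proof.
rewrite -(fsbig_fiber _ (fun b : block => b.1)) /p_tensor.
apply: eq_fsbigr => k _; rewrite -big_filter.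
transitivity (\prod_(r <- [seq b.2 | b <- tau & b.1 == k]) psum k r) => //.
rewrite big_map !big_filter.
by apply: eq_bigr => b /eqP ->.
Qed.

Lemma p_tensor_adjoin sigma bs :
  p_tensor (adjoin sigma bs) = p_tensor sigma * \prod_(b <- bs) psum b.1 b.2.
Proof. by rewrite !p_tensorE -big_cat; apply: perm_big; rewrite perm_sort. Qed.

(** * Substituting powers of the variables *)

Lemma mpow_msetn (e r : nat) v : mpow e (msetn r v) = msetn (e * r) v.
Proof.
by apply/msetP => w; rewrite mpowE !msetnE; case: eqP => _; rewrite ?muln0.
Qed.

(** The coefficient of m in [spow e f] is the coefficient of a in f if m is the
    e-th power of a, and zero if m is not an e-th power. *)
Lemma mpow_dec (e : posnat) (m : monom) :
  {a | m = mpow e a} + {forall a, m != mpow e a}.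
Proof.
have [/cid[a ->]|H] := pselect (exists a, m = mpow e a); first by left; exists a.
by right=> a; apply/eqP => E; apply: H; exists a.
Qed.

Lemma coef_psum k r m : coef (psum k r) m =
  \sum_(j \in [set: posnat]%classic) ((m == msetn r (k, j))%:R : rat).
Proof. by apply: eq_fsbigr => j _; rewrite xvarX. Qed.

Lemma pow_subst_psum (e k : posnat) r : pow_subst e (psum k r) = psum k (e * r).
Proof.
apply/val_inj/seriesP => m; rewrite [RHS]coef_psum.
have [[a ->]|mN] := mpow_dec e m.
  rewrite coef_spow [LHS]coef_psum; apply: eq_fsbigr => j _.
  by rewrite -mpow_msetn (inj_eq (@mpow_inj e)).
rewrite coef_spow0 // fsbig1 // => j _.
by rewrite -mpow_msetn (negbTE (mN _)).
Qed.

Lemma pow_subst_linear (e : posnat) : linear (pow_subst e).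
Proof.
move=> a f g; apply/val_inj/seriesP => m.
change (coef (spow e (a *: psval f + psval g)) m =
        a * coef (spow e f) m + coef (spow e g) m).
have [[n ->]|mN] := mpow_dec e m; last by rewrite !coef_spow0 ?mulr0 ?addr0.
by rewrite !coef_spow.
Qed.

HB.instance Definition _ (e : posnat) :=
  GRing.isLinear.Build rat PLambda PLambda _ (pow_subst e) (pow_subst_linear e).

(** * Expanding the product of the P_b over the blocks b of delta *)

Definition posdivs (d : posnat) : seq posnat := pmap insub (divisors d).

Lemma mem_posdivs (d k : posnat) : (k \in posdivs d) = (k %| d)%N.
Proof. by rewrite mem_pmap_sub -dvdn_divisors ?posnat_gt0. Qed.

Lemma posdivs_uniq d : uniq (posdivs d).
Proof. by rewrite pmap_sub_uniq ?divisors_uniq. Qed.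

(** The blocks k^r with k | d and r k = d m, for b = d^m: in a tableau, the
    row holding the value attached to b is one of these. *)
Definition splits (b c : block) : bool :=
  (c.1 %| b.1)%N && (c.2 * c.1 == b.1 * b.2)%N.

(** [b.2] is a default, never taken when k divides [b.1]. *)
Definition split_block (b : block) (k : posnat) : block :=
  (k, insubd b.2 (b.2 * (b.1 %/ k)))%N.

Lemma split_block2 (b : block) (k : posnat) :
  (k %| b.1)%N -> (split_block b k).2 = (b.2 * (b.1 %/ k))%N :> nat.
Proof.
move=> kb; rewrite insubdK // -topredE /= muln_gt0 posnat_gt0 divn_gt0 ?posnat_gt0 //.
by rewrite dvdn_leq ?posnat_gt0.
Qed.

Definition block_splits (b : block) : seq block :=
  [seq split_block b k | k <- posdivs b.1].

Lemma mem_block_splits b c : (c \in block_splits b) = splits b c.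
Proof.
apply/mapP/andP => [[k +]|[kb /eqP cb]]; rewrite ?mem_posdivs.
  by move=> kb -> /=; rewrite (split_block2 kb) -mulnA divnK // mulnC kb.
exists c.1; rewrite ?mem_posdivs //; case: c kb cb => k r /= kb cb.
congr (_, _); apply: val_inj; rewrite /= split_block2 //.
apply/eqP; rewrite -(eqn_pmul2r (posnat_gt0 k)) -mulnA divnK //.
by rewrite cb mulnC.
Qed.

Lemma block_splits_uniq b : uniq (block_splits b).
Proof. by rewrite map_inj_uniq ?posdivs_uniq // => k l []. Qed.

(** The summand k p_(d/k)(x_k) of P_d becomes k p_(m d / k)(x_k), whose
    index is the length r of a row with r k = d m. *)
Lemma P_blockE b :
  P_block b = \sum_(c <- block_splits b) (c.1%:R : rat) *: psum c.1 c.2.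
Proof.
rewrite /P_block.
have -> : P_deg b.1 = \sum_(k <- posdivs b.1) (k%:R : rat) *: psum k (b.1 %/ k).
  rewrite /P_deg (fsbigE (posdivs b.1)) ?posdivs_uniq //=.
  - rewrite [LHS]big_mkcond big_seq [RHS]big_seq; apply: eq_bigr => k.
    by rewrite mem_posdivs => kb; rewrite mem_set //= scaler_nat mulr_natl.
  - by move=> k /=; rewrite mem_posdivs.
  - by move=> k /= kb; rewrite mem_posdivs kb.
rewrite linear_sum big_map big_seq [RHS]big_seq.
apply: eq_bigr => k; rewrite mem_posdivs => kb.
by rewrite linearZ /= pow_subst_psum split_block2.
Qed.

Fixpoint splittings (delta : seq block) : seq (seq block) :=
  if delta is b :: delta' then
    [seq c :: bs | c <- block_splits b, bs <- splittings delta']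
  else [:: [::]].

Lemma mem_splittings delta bs : (bs \in splittings delta) = all2 splits delta bs.
Proof.
elim: delta bs => [|b delta IH] [|c bs] //=.
  by apply/allpairsP => -[[? ?] []].
apply/allpairsP/andP => [[[c' bs'] /= [+ + [-> ->]]]|[bc dbs]].
  by rewrite mem_block_splits IH.
by exists (c, bs); rewrite mem_block_splits IH.
Qed.

Lemma splittings_uniq delta : uniq (splittings delta).
Proof.
elim: delta => //= b delta IH; rewrite allpairs_uniq ?block_splits_uniq //.
by case=> [? ?] [? ?] _ _ [-> ->].
Qed.

Lemma P_seqE delta : P_seq delta = \sum_(bs <- splittings delta)
  ((\prod_(c <- bs) c.1)%N%:R : rat) *: \prod_(c <- bs) psum c.1 c.2.
Proof.
rewrite /P_seq; elim: delta => [|b delta IH] /=.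
  by rewrite !big_nil big_seq1 !big_nil scale1r.
rewrite big_cons IH P_blockE big_distrl big_allpairs_dep /=.
apply: eq_bigr => c _; rewrite big_distrr /=; apply: eq_bigr => bs _.
by rewrite !big_cons -scalerAr -scalerAl scalerA natrM mulrC.
Qed.

(** * Rows of a diagram and their labels *)

Local Open Scope nat_scope.

Lemma count_nth_iota (T : eqType) (x0 : T) (a : pred T) (s : seq T) :
  count (fun i => a (nth x0 s i)) (iota 0 (size s)) = count a s.
Proof. by rewrite -[in RHS](mkseq_nth x0 s) count_map. Qed.

Lemma count_restr (tau : btype) (b : block) :
  count_mem b.2 (restr tau b.1) = count_mem b tau.
Proof.
case: b => k r; rewrite count_map count_filter; apply: eq_count => -[l q] /=.
by rewrite xpair_eqE andbC.
Qed.

Lemma size_restr (tau : btype) k :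
  size (restr tau k) = count (fun b : block => b.1 == k) tau.
Proof. by rewrite /restr /= size_map size_filter. Qed.

(** For i out of range the length is a default. *)
Definition row_block (tau : btype) (k : posnat) (i : nat) : block :=
  (k, nth k (restr tau k) i).

Lemma row_lenE (tau : btype) k i : i < size (restr tau k) ->
  row_len (restr tau k) i = (row_block tau k i).2.
Proof. by move=> ik; rewrite /row_len (nth_map k). Qed.

Lemma row_len_gt0 (tau : btype) k i :
  (0 < row_len (restr tau k) i) = (i < size (restr tau k)).
Proof.
have [ik|ki] := ltnP i (size (restr tau k)).
  by rewrite row_lenE // posnat_gt0.
by rewrite /row_len nth_default // size_map.
Qed.

Definition rows (tau : btype) (b : block) : seq nat :=
  [seq i <- iota 0 (size (restr tau b.1)) | row_block tau b.1 i == b].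

Lemma mem_rows tau b i :
  (i \in rows tau b) = (i < size (restr tau b.1)) && (row_block tau b.1 i == b).
Proof. by rewrite mem_filter mem_iota andbC. Qed.

Lemma mem_rows_block (tau : btype) k i : i < size (restr tau k) ->
  i \in rows tau (row_block tau k i).
Proof. by move=> ik; rewrite mem_rows ik eqxx. Qed.

Lemma rows_uniq tau b : uniq (rows tau b).
Proof. by rewrite filter_uniq ?iota_uniq. Qed.

Lemma rows_sorted tau b : sorted ltn (rows tau b).
Proof. by apply: sorted_filter; [exact: ltn_trans | exact: iota_ltn_sorted]. Qed.

Lemma size_rows tau b : size (rows tau b) = count_mem b tau.
Proof.
case: b => k r; rewrite size_filter -count_restr -(count_nth_iota k).
by apply: eq_count => i; rewrite xpair_eqE eqxx.
Qed.

(** The label is read in the first cell, which every row has. For i out of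
    range there is no such cell, and the label is 0. *)
Definition row_label (tau : btype) (delta : seq block) (T : filling tau delta)
    (k : posnat) (i : nat) : nat :=
  oapp (fun u => T u : nat) 0 (insub (k, (i, 0)) : option (tensor_dg tau)).

Definition row_constant (tau : btype) (delta : seq block)
    (T : filling tau delta) : Prop :=
  forall k i u v, in_row k i u -> in_row k i v -> T u = T v.

Lemma row_head (tau : btype) k i : i < size (restr tau k) ->
  exists2 u : tensor_dg tau, in_row k i u & col_of u = 0.
Proof.
move=> ik; have kiP : (k, (i, 0)) \in tensor_dg tau.
  by rewrite mem_tensor_dg mem_dg row_len_gt0.
by exists [` kiP]%fset; rewrite // /in_row /comp_of /row_of /= !eqxx.
Qed.

Lemma in_row_size (tau : btype) k i (u : tensor_dg tau) :
  in_row k i u -> i < size (restr tau k).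
Proof.
case: u => -[l [j c]] uP /andP[/eqP <- /eqP <-]; rewrite /comp_of /row_of /=.
rewrite -row_len_gt0; move: uP; rewrite mem_tensor_dg mem_dg.
exact: leq_ltn_trans.
Qed.

Lemma row_label_head tau delta (T : filling tau delta) k i u :
  in_row k i u -> col_of u = 0 -> row_label T k i = T u.
Proof.
case: u => -[l [j c]] uP /andP[/eqP + /eqP +].
rewrite /comp_of /row_of /col_of /= => kl ij c0; subst.
by rewrite /row_label insubT.
Qed.

Lemma row_labelE tau delta (T : filling tau delta) k i u :
  row_constant T -> in_row k i u -> row_label T k i = T u.
Proof.
move=> Tc ku; have [v kv v0] := row_head (in_row_size ku).
by rewrite (row_label_head _ kv v0) (Tc _ _ _ _ ku kv).
Qed.

Definition labels (tau : btype) (delta : seq block) (T : filling tau delta)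
    (b : block) : seq nat :=
  [seq row_label T b.1 i | i <- rows tau b].

(** The only possible sequence of labels on the copies of b in a tableau, read
    downwards: the rows of sigma come first, then the t + 1 for which the entry
    t of bs is b, in increasing order. *)
Definition standard_labels (sigma : btype) (bs : seq block) (b : block) :
    seq nat :=
  nseq (count_mem b sigma) 0 ++
  [seq t.+1 | t <- iota 0 (size bs) & nth b bs t == b].

Lemma size_standard_labels sigma bs b :
  size (standard_labels sigma bs b) = count_mem b (sigma ++ bs).
Proof.
rewrite size_cat size_nseq size_map size_filter count_cat.
by rewrite (count_nth_iota _ (pred1 b)).
Qed.

Lemma standard_labels_sorted sigma bs b :
  sorted leq (standard_labels sigma bs b).
Proof.
rewrite /standard_labels; elim: (count_mem b sigma) => [|n IH] /=.
  rewrite sorted_map; apply: sorted_filter; first by move=> ? ? ?; exact: leq_trans.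
  by apply: (sub_sorted _ (iota_ltn_sorted _ _)) => i j /ltnW.
by rewrite path_min_sorted //; apply/allP.
Qed.

Lemma count_standard_labels0 sigma bs b :
  count_mem 0 (standard_labels sigma bs b) = count_mem b sigma.
Proof.
rewrite count_cat count_nseq /= mul1n count_map.
by rewrite [X in _ + X](eq_count (a2 := pred0)) ?count_pred0 ?addn0.
Qed.

Lemma count_standard_labelsS sigma bs b t :
  count_mem t.+1 (standard_labels sigma bs b) =
  (t < size bs) && (nth b bs t == b).
Proof.
rewrite count_cat count_nseq /= mul0n add0n count_map.
rewrite (eq_count (a2 := pred1 t)) // count_uniq_mem; last first.
  by rewrite filter_uniq ?iota_uniq.
by rewrite mem_filter mem_iota andbC.
Qed.

Lemma standard_labels_le sigma bs b j :
  nth 0 (standard_labels sigma bs b) j <= size bs.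
Proof.
have [jlt|jge] := ltnP j (size (standard_labels sigma bs b)); last first.
  by rewrite nth_default.
have := mem_nth 0 jlt; rewrite mem_cat => /orP[/nseqP[-> //]|/mapP[t + ->]].
by rewrite mem_filter mem_iota => /andP[].
Qed.

(** The row i is the copy number [index i (rows tau b)] of its block b. *)
Definition fill_label (tau sigma : btype) (bs : seq block) k i : nat :=
  nth 0 (standard_labels sigma bs (row_block tau k i))
        (index i (rows tau (row_block tau k i))).

Definition fill (tau sigma : btype) (delta bs : seq block) :
    filling tau delta :=
  [ffun u => inord (fill_label tau sigma bs (comp_of u) (row_of u))].

Lemma fillE tau sigma delta bs k i u : size bs = size delta ->
  in_row k i u -> fill tau sigma delta bs u = fill_label tau sigma bs k i :> nat.
Proof.
move=> sbs /andP[/eqP<- /eqP<-]; rewrite ffunE inordK // ltnS -sbs.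
exact: standard_labels_le.
Qed.

Lemma fill_row_constant tau sigma delta bs : size bs = size delta ->
  row_constant (fill tau sigma delta bs).
Proof.
move=> sbs k i u v ku kv; apply: val_inj.
by rewrite /= (fillE _ sbs ku) (fillE _ sbs kv).
Qed.

Lemma labels_fill (tau sigma : btype) delta bs b : size bs = size delta ->
  perm_eq tau (sigma ++ bs) ->
  labels (fill tau sigma delta bs) b = standard_labels sigma bs b.
Proof.
move=> sbs /permP tauE.
have sE : size (rows tau b) = size (standard_labels sigma bs b).
  by rewrite size_rows size_standard_labels tauE.
apply: (@eq_from_nth _ 0) => [|j]; rewrite size_map // => jlt.
rewrite (nth_map 0) //; have := mem_nth 0 jlt.
rewrite mem_rows => /andP[ik /eqP ib].
have [u ku u0] := row_head ik; rewrite (row_label_head _ ku u0) (fillE _ sbs ku).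
by rewrite /fill_label ib index_uniq ?rows_uniq.
Qed.

(** Every cell lies in a row that is a copy of some block, so the labels on the
    copies of all the blocks give all the values of the filling. *)
Lemma labels_inj tau delta (T U : filling tau delta) :
  row_constant T -> row_constant U -> labels T =1 labels U -> T = U.
Proof.
move=> Tc Uc TU; apply/ffunP => u; apply: val_inj => /=.
have ku : in_row (comp_of u) (row_of u) u by rewrite /in_row !eqxx.
rewrite -(row_labelE Tc ku) -(row_labelE Uc ku).
have /eq_in_map := TU (row_block tau (comp_of u) (row_of u)); apply.
exact/mem_rows_block/(in_row_size ku).
Qed.

(** For each block b both sides count the labels on the copies of b. *)
Lemma labels_perm tau delta (T : filling tau delta) sigma bs :
  (forall b, labels T b = standard_labels sigma bs b) ->
  perm_eq tau (sigma ++ bs).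
Proof.
move=> TE; apply/allP => b _ /=.
by rewrite -size_rows -size_standard_labels -TE size_map.
Qed.

Lemma count_labels tau delta (T : filling tau delta) b v :
  count_mem v (labels T b) =
  count (fun i => (row_label T b.1 i == v) && (row_block tau b.1 i == b))
    (iota 0 (size (restr tau b.1))).
Proof. by rewrite count_map count_filter. Qed.

Lemma zero_rowE tau delta (T : filling tau delta) k i :
  row_constant T -> i < size (restr tau k) ->
  zero_row T k i = (row_label T k i == 0).
Proof.
move=> Tc ik; apply/forallP/eqP => [T0|T0 u]; last first.
  by apply/implyP => ku; rewrite -val_eqE /= -(row_labelE Tc ku) T0.
have [u ku u0] := row_head ik.
by rewrite (row_label_head _ ku u0); have := T0 u; rewrite ku => /eqP ->.
Qed.

(** The condition on the zero rows, read block by block: two partitions agree iff each part has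
    the same multiplicity in both, and a part r of component k is the block
    k^r. *)
Lemma zero_rows_perm tau delta (T : filling tau delta) (sigma : btype) :
  row_constant T ->
  (forall k, perm_eq [seq row_len (restr tau k) i |
               i <- iota 0 (size (restr tau k)) & zero_row T k i]
            [seq pn r | r <- restr sigma k]) <->
  (forall b, count_mem 0 (labels T b) = count_mem b sigma).
Proof.
move=> Tc.
pose zs k := [seq (row_block tau k i).2 |
  i <- iota 0 (size (restr tau k)) & row_label T k i == 0].
have zsE k : [seq row_len (restr tau k) i |
    i <- iota 0 (size (restr tau k)) & zero_row T k i] = [seq pn r | r <- zs k].
  rewrite -map_comp (eq_in_filter (a2 := fun i => row_label T k i == 0)).
    by apply/eq_in_map => i; rewrite mem_filter mem_iota => /andP[_]; exact: row_lenE.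
  by move=> i; rewrite mem_iota; exact: zero_rowE.
have zs_count b : count_mem b.2 (zs b.1) = count_mem 0 (labels T b).
  case: b => k r; rewrite count_labels count_map count_filter.
  by apply: eq_count => i /=; rewrite xpair_eqE eqxx andbC.
split=> [zP b|zP k].
  rewrite -zs_count -count_restr; have := zP b.1; rewrite zsE.
  by move/(perm_map_inj val_inj)/permP ->.
rewrite zsE perm_map //; apply/allP => r _ /=.
by rewrite (zs_count (k, r)) (count_restr sigma (k, r)) zP.
Qed.

(** * Tableaux and splittings *)

(** Everything is read off the standard labels. The value t + 1 occurs once
    among the labels on the copies of the entry t of bs and nowhere else, which
    gives the unique row and its block; the number of zeros gives the
    zero rows of sigma; and the labels increase because the standard ones do. *)
Lemma ICRPT_of_labels (tau sigma : btype) delta (T : filling tau delta) bs :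
  row_constant T -> all2 splits delta bs ->
  (forall b, labels T b = standard_labels sigma bs b) -> is_ICRPT sigma T.
Proof.
move=> Tc; rewrite all2E => /andP[/eqP sbs dbs] TE.
have label_block k i u t : in_row k i u -> T u = t.+1 :> nat ->
    t < size bs /\ nth (row_block tau k i) bs t = row_block tau k i.
  move=> ku Tu.
  have : t.+1 \in labels T (row_block tau k i).
    by rewrite -Tu -(row_labelE Tc ku) map_f // mem_rows_block // (in_row_size ku).
  by rewrite TE -has_pred1 has_count count_standard_labelsS lt0b => /andP[? /eqP].
split=> //.
- move=> t; have tb : t < size bs by rewrite -sbs.
  (* The default is arbitrary, since t is smaller than the size of bs. *)
  pose b := nth (tnth (in_tuple delta) t) bs t.
  have tE : nth b bs t = b by apply: set_nth_default.
  have /mapP[i + ti] : t.+1 \in labels T b.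
    by rewrite TE -has_pred1 has_count count_standard_labelsS tb tE eqxx.
  rewrite mem_rows => /andP[ik /eqP ib]; have [u ku u0] := row_head ik.
  exists (b.1, i); split=> [|[l j] /= [v lv Tv]].
    by exists u; rewrite // ti (row_label_head _ ku u0).
  have [_ jb] := label_block _ _ _ _ lv Tv.
  rewrite (set_nth_default b) // tE in jb.
  have bl : b.1 = l by rewrite jb.
  rewrite bl; congr (_, _); move: jb; rewrite -bl => jb.
  (* Rows i and j are both copies of b labelled t + 1, and there is only one. *)
  have := count_labels T b t.+1.
  rewrite TE count_standard_labelsS tb tE eqxx -size_filter /=.
  set s := [seq _ <- _ | _] => s1.
  have s_i : i \in s by rewrite mem_filter -ti ib !eqxx mem_iota.
  have s_j : j \in s.
    rewrite mem_filter mem_iota /= add0n -jb eqxx andbT bl (in_row_size lv) andbT.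
    by rewrite (row_labelE Tc lv) Tv.
  by case: (s) s1 s_i s_j => [|x [|//]] // _; rewrite !inE => /eqP-> /eqP->.
- move=> t k i u ku Tu.
  have [tb tE] := label_block _ _ _ _ ku Tu.
  have := (all_nthP (row_block tau k i, row_block tau k i) dbs) t.
  rewrite size_zip -sbs minnn => /(_ (ltn_ord t)).
  rewrite /= nth_zip // tE /= => /andP[/= kt /eqP rt].
  by rewrite (row_lenE (in_row_size ku)) (tnth_nth (row_block tau k i)).
- by apply/zero_rows_perm => // b; rewrite TE count_standard_labels0.
- move=> k i j u v + ij ku kv u0 v0.
  have [ik jk] := (in_row_size ku, in_row_size kv).
  rewrite !row_lenE // => /val_inj ijE.
  have bE : row_block tau k i = row_block tau k j by congr (_, _).
  rewrite -(row_labelE Tc ku) -(row_labelE Tc kv).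
  pose le_lab x y := row_label T k x <= row_label T k y.
  have rs : sorted le_lab (rows tau (row_block tau k i)).
    have := standard_labels_sorted sigma bs (row_block tau k i).
    by rewrite -TE sorted_map.
  apply: (sorted_leq_index _ _ rs); rewrite ?mem_rows_block //.
  + by move=> ? ? ?; exact: leq_trans.
  + by move=> ?; exact: leqnn.
  + by rewrite bE mem_rows_block.
  rewrite leqNgt; apply: contraL ij => /(sorted_ltn_index ltn_trans (rows_sorted _ _)).
  by rewrite -ltnNge; apply; rewrite ?mem_rows_block // bE mem_rows_block.
Qed.

(** Entry t of the splitting is the block of the unique row labelled t + 1. The
    labels on the copies of b and the standard labels are then two sorted
    sequences in which every value has the same multiplicity. *)
Lemma ICRPT_labels (tau sigma : btype) delta (T : filling tau delta) :
  is_ICRPT sigma T -> exists2 bs, all2 splits delta bs &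
    forall b, labels T b = standard_labels sigma bs b.
Proof.
case=> Tc Tuniq Tblock /(zero_rows_perm _ Tc) T0 Tinc.
have {}Tuniq (t : 'I_(size delta)) : {g : posnat * nat |
    (exists2 u, in_row g.1 g.2 u & T u = t.+1 :> nat) /\
    forall k i u, in_row k i u -> T u = t.+1 :> nat -> g = (k, i)}.
  apply/cid; have [g [gt gU]] := Tuniq t; exists g; split=> // k i u ku Tu.
  by apply: gU; exists u.
pose g t := sval (Tuniq t).
pose bs := [seq row_block tau (g t).1 (g t).2 | t <- enum 'I_(size delta)].
have sbs : size bs = size delta by rewrite size_map size_enum_ord.
have bsE b (t : 'I_(size delta)) : nth b bs t = row_block tau (g t).1 (g t).2.
  by rewrite (nth_map t) ?size_enum_ord // nth_ord_enum.
exists bs.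
  rewrite all2E sbs eqxx /=; pose one : posnat := PosNat (isT : 0 < 1).
  pose b0 : block := (one, one).
  apply/(all_nthP (b0, b0)) => j; rewrite size_zip sbs minnn => jlt.
  rewrite nth_zip // -[j]/(val (Ordinal jlt)) /= (bsE _ (Ordinal jlt)).
  have [[u gu Tu] _] := svalP (Tuniq (Ordinal jlt)).
  have [kt] := Tblock _ _ _ _ gu Tu.
  rewrite (row_lenE (in_row_size gu)) (tnth_nth b0) => /eqP rt.
  by apply/andP; split=> //; move: kt; rewrite (tnth_nth b0).
move=> b; apply: (sorted_eq leq_trans anti_leq _ (standard_labels_sorted _ _ _)).
  rewrite sorted_map.
  apply: (sub_in_sorted (P := [in rows tau b])) (rows_sorted tau b);
    last exact/allP.
  move=> i j; rewrite ![_ \in _]mem_rows => /andP[ik /eqP ib] /andP[jk /eqP jb] /ltnW ij.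
  have [[u ku u0] [v kv v0]] := (row_head ik, row_head jk).
  rewrite /= (row_label_head _ ku u0) (row_label_head _ kv v0).
  by apply: (Tinc b.1 i j) => //; rewrite !row_lenE // ib jb.
apply/allP => -[|t] _; apply/eqP; first by rewrite T0 count_standard_labels0.
rewrite count_standard_labelsS sbs.
have [tlt|tge] := ltnP t (size delta); last first.
  apply/eqP; rewrite -leqn0 leqNgt -has_count has_pred1; apply/mapP => -[i].
  rewrite mem_rows => /andP[ik _] ti; have [u ku u0] := row_head ik.
  have := ltn_ord (T u); rewrite -(row_label_head _ ku u0) -ti ltnS.
  by rewrite ltnNge tge.
rewrite -[t in nth _ _ t]/(val (Ordinal tlt)) bsE /=.
have [[u gu Tu] gU] := svalP (Tuniq (Ordinal tlt)).
rewrite -/(g _) in gu gU *; move: (g _) gu gU => [k i] /= ku gU.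
have ik := in_row_size ku.
have tlab : row_label T k i = t.+1 by rewrite (row_labelE Tc ku).
have labU l j : j < size (restr tau l) -> row_label T l j = t.+1 -> (k, i) = (l, j).
  move=> jl jt; have [v lv v0] := row_head jl.
  by apply: (gU _ _ v); rewrite // -(row_label_head _ lv v0).
rewrite count_labels; have [<-|kib] := eqVneq (row_block tau k i) b; last first.
  apply/eqP; rewrite -leqn0 leqNgt -has_count; apply/hasP => -[j].
  rewrite mem_iota => /= jb /andP[/eqP jt /eqP jE].
  by have [kb ij] := labU _ _ jb jt; move/eqP: kib; apply; rewrite kb ij.
rewrite (eq_in_count (a2 := pred1 i)) => [|j].
  by rewrite count_uniq_mem ?iota_uniq // mem_iota ik.
rewrite mem_iota => /= jk; apply/andP/eqP => [[/eqP jt _]|->].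
  by have [] := labU _ _ jk jt.
by rewrite tlab !eqxx.
Qed.

(** The rows of component k number as many as the blocks of degree k in tau, and
    its zero rows as many as those in sigma. The difference
    is the number of blocks of degree k in bs. *)
Lemma wt_ICRPT (tau sigma : btype) delta (T : filling tau delta) bs :
  is_ICRPT sigma T -> perm_eq tau (sigma ++ bs) ->
  wt T = \prod_(c <- bs) c.1.
Proof.
move=> Ti /permP tauE; have Tc := icrpt_row_constant Ti.
have nzE k : n_nonzero T k = count (fun c : block => c.1 == k) bs.
  have := perm_size (icrpt_zero_rows Ti k).
  rewrite size_map size_filter (size_map pn (restr sigma k)) (size_restr sigma) => zE.
  have := count_predC (zero_row T k) (iota 0 (size (restr tau k))).
  rewrite size_iota zE {2}size_restr tauE count_cat => /addnI <-.
  rewrite /n_nonzero; apply: eq_in_count => i; rewrite mem_iota => /= ik.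
  have [u ku u0] := row_head ik.
  rewrite (zero_rowE Tc ik) (row_label_head _ ku u0).
  apply/existsP/idP => [[v /andP[kv]]|nz].
    by rewrite (Tc _ _ _ _ kv ku).
  by exists u; rewrite ku.
rewrite -(fsbig_fiber _ (fun c : block => c.1)); apply: eq_fsbigr => k _.
rewrite nzE (eq_bigr (fun=> k : nat)) => [|c /eqP -> //].
by rewrite big_const_seq iter_muln_1.
Qed.

(** Distinct splittings give distinct fillings, because entry t of bs can be
    recovered as the block b such that t + 1 is among the labels on the copies
    of b. *)
Lemma perm_ICRPT (tau sigma : btype) delta :
  perm_eq (enum (ICRPT tau sigma delta))
    [seq fill tau sigma delta bs |
       bs <- splittings delta & perm_eq tau (sigma ++ bs)].
Proof.
have size_splits bs : all2 splits delta bs -> size bs = size delta.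
  by rewrite all2E => /andP[/eqP].
apply: uniq_perm; first exact: enum_uniq.
  rewrite map_inj_in_uniq ?filter_uniq ?splittings_uniq // => bs cs.
  rewrite !mem_filter !mem_splittings.
  move=> /andP[tb /size_splits sb] /andP[tc /size_splits sc] bcE.
  have lE b : standard_labels sigma bs b = standard_labels sigma cs b.
    by rewrite -(labels_fill _ sb tb) bcE labels_fill.
  case: bs {tb bcE} sb lE => [|b0 bs] sb lE.
    by case: cs sc {tc lE}; rewrite -sb.
  apply: (@eq_from_nth _ b0) => [|t tb]; first by rewrite sb sc.
  pose b := nth b0 (b0 :: bs) t.
  have := count_standard_labelsS sigma cs b t; rewrite -lE count_standard_labelsS.
  rewrite sc -sb tb (set_nth_default b0) // eqxx (set_nth_default b0) ?sc -?sb //.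
  by case: eqP => // ->.
move=> T; rewrite mem_enum inE; apply/asboolP/mapP => [Ti|[bs + ->]]; last first.
  rewrite mem_filter mem_splittings => /andP[tb db].
  apply: (ICRPT_of_labels (bs := bs)) => //.
    exact/fill_row_constant/size_splits.
  by move=> b; apply: labels_fill; rewrite ?size_splits.
have [bs db TE] := ICRPT_labels Ti; have tb := labels_perm TE.
exists bs; first by rewrite mem_filter mem_splittings tb db.
apply: labels_inj => [||b]; first exact: icrpt_row_constant Ti.
  exact/fill_row_constant/size_splits.
by rewrite TE labels_fill ?size_splits.
Qed.

Local Close Scope nat_scope.

Theorem theorem40 (sigma : btype) (delta : seq block) :
  p_tensor sigma * P_seq delta =
  \sum_(tau \in [set: btype]%classic)
    (\sum_(T in ICRPT tau sigma delta) (wt T)%:R : rat) *: p_tensor tau.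
Proof.
rewrite P_seqE big_distrr -(fsbig_fiber _ (adjoin sigma)) /=.
apply: eq_fsbigr => tau _.
have -> : \sum_(T in ICRPT tau sigma delta) (wt T)%:R =
  \sum_(bs <- splittings delta | adjoin sigma bs == tau)
    (\prod_(c <- bs) c.1)%N%:R :> rat.
  rewrite -big_enum (perm_big _ (perm_ICRPT _ _ _)) big_map.
  under [RHS]eq_bigl do rewrite adjoin_eq.
  rewrite -[RHS]big_filter big_seq [RHS]big_seq; apply: eq_bigr => bs bsP.
  rewrite (wt_ICRPT (sigma := sigma) (bs := bs)) //; last first.
    by move: bsP; rewrite mem_filter => /andP[].
  have := map_f (fill tau sigma delta) bsP.
  by rewrite -(perm_mem (perm_ICRPT _ _ _)) mem_enum inE => /asboolP.
rewrite scaler_suml; apply: eq_bigr => bs /eqP <-.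
by rewrite p_tensor_adjoin scalerAr.
Qed.
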